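(* Let $\Gamma\subset\mathbf{R}^n$ be an almost periodic pattern. Then for every $\varepsilon>0$, the set $\mathcal{N}_\varepsilon$ of $\varepsilon$-almost-periods of $\Gamma$ contains a relatively dense almost periodic pattern.
   Context: Fix an integer $n\ge 1$. Balls are taken with respect to the sup norm: $B(x,R)=\{y\in\mathbf{R}^n : |x_i-y_i|<R \text{ for all } i\}$, and $B_R=B(0,R)$. $\Delta$ denotes symmetric difference. Delone set: $\Gamma\subset\mathbf{R}^n$ is relatively dense if there is $R_\Gamma>0$ such that each ball of radius at least $R_\Gamma$ contains at least one point of $\Gamma$; uniformly discrete if there is $r_\Gamma>0$ such that each ball of radius at most $r_\Gamma$ contains at most one point of $\Gamma$; Delone if both. For $R>0$ and $E\subset\mathbf{R}^n$, $D_R^+(E)=\sup_{x\in\mathbf{R}^n}\frac{\mathrm{Card}(E\cap B(x,R))}{\mathrm{Vol}(B_R)}$. For $\varepsilon,R'>0$ let $\mathcal{N}_\varepsilon^{R'}=\{v\in\mathbf{R}^n : \forall R\ge R',\ D_R^+((\Gamma+v)\Delta\Gamma)<\varepsilon\}$ and $\mathcal{N}_\varepsilon=\bigcup_{R'>0}\mathcal{N}_\varepsilon^{R'}$. An almost periodic pattern is a Delone set $\Gamma\subset\mathbf{R}^n$ such that for every $\varepsilon>0$ there exists $R_\varepsilon>0$ for which $\mathcal{N}_\varepsilon^{R_\varepsilon}$ is relatively dense. *)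

(* Defs.v *)
From HB Require Import structures.
From mathcomp Require Import all_boot all_order all_algebra.
From mathcomp Require Import all_classical all_reals all_analysis.

Set Implicit Arguments.
Unset Strict Implicit.
Unset Printing Implicit Defensive.

Import Order.TTheory GRing.Theory Num.Theory.
Import numFieldNormedType.Exports.

Local Open Scope classical_set_scope.
Local Open Scope ring_scope.

(* Points of R^n are row vectors: the library's
   [ball] on matrices is the open ball of the sup norm, and it is empty for
   radii <= 0. *)

Definition relatively_dense (R : realType) (n : nat) (G : set 'rV[R]_n) : Prop :=
  exists2 RG : R, 0 < RG &
    forall (x : 'rV[R]_n) (r : R), RG <= r -> G `&` ball x r !=set0.

Definition uniformly_discrete (R : realType) (n : nat) (G : set 'rV[R]_n) : Prop :=
  exists2 rG : R, 0 < rG &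
    forall (x : 'rV[R]_n) (r : R), r <= rG -> is_subset1 (G `&` ball x r).

Definition delone (R : realType) (n : nat) (G : set 'rV[R]_n) : Prop :=
  relatively_dense G /\ uniformly_discrete G.

(* Vol(B_r): B_r is the product of n copies of the interval ball 0 r of R, so
   its n-dimensional volume is the product of their Lebesgue measures, that is
   (2r)^n when 0 < r. *)
Definition vol_ball (R : realType) (n : nat) (r : R) : R :=
  \prod_(i < n) fine (lebesgue_measure (ball (0 : R) r)).

(* Extended-real valued: [counting] is +oo on infinite sets, and the supremum
   over the centres may be infinite. *)
Definition upper_density (R : realType) (n : nat) (r : R) (E : set 'rV[R]_n) :
    \bar R :=
  ereal_sup
    [set (counting (E `&` ball x r) * ((vol_ball n r)^-1)%:E)%E
      | x in [set: 'rV[R]_n]].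

Definition translate (R : realType) (n : nat) (G : set 'rV[R]_n)
    (v : 'rV[R]_n) : set 'rV[R]_n :=
  [set g + v | g in G].

Definition almost_periods_from (R : realType) (n : nat) (G : set 'rV[R]_n)
    (eps R' : R) : set 'rV[R]_n :=
  [set v | forall r : R, R' <= r ->
    (upper_density r (translate G v `+` G) < eps%:E)%E].

Definition almost_periods (R : realType) (n : nat) (G : set 'rV[R]_n)
    (eps : R) : set 'rV[R]_n :=
  \bigcup_(R' in [set s : R | 0 < s]) almost_periods_from G eps R'.

Definition almost_periodic_pattern (R : realType) (n : nat)
    (G : set 'rV[R]_n) : Prop :=
  delone G /\
  forall eps : R, 0 < eps ->
    exists2 Reps : R, 0 < Reps &
      relatively_dense (almost_periods_from G eps Reps).

(* Main.v *)
Require Import Defs.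
From mathcomp Require Import all_boot all_order all_algebra.
From mathcomp Require Import finmap.
From mathcomp Require Import all_classical all_reals all_analysis.
From mathcomp Require Import ring lra.

(** Write [N a] for the set of [a]-almost-periods of [G].  It behaves like a
    sublevel set of a pseudo-norm: it is increasing in [a], symmetric, and
    [N a + N b] is contained in [N (a + b)].  Since [G] is uniformly discrete
    and has positive density, a short nonzero vector moves [G] off itself and so
    is not in [N e] for small [e]; hence [N e] is uniformly discrete.

    The pattern is [N t] for a well-chosen [t < min e eps].  A vector [w] of
    [N d] moves [N t] by a subset of the shell [N (t + d) \ N (t - d)], so it is
    enough that thin shells have small density.  Translating by elements of
    [N d], which are relatively dense, brings a ball of radius [r] with
    arbitrary centre to within the ball of radius [2 r] about 0, at the price of
    thickening the shell to [N (t + 2 d) \ N (t - 2 d)]; for given [eta > 0],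
    disjointness of the shells leaves only finitely many [t] for which these
    contain more than [eta * (2 r)^n] points for all [d] and all large [r].  So
    all but countably many [t] work.  A density bound at one radius propagates
    to all larger radii up to a factor [3^n], by covering. *)

Set Implicit Arguments.
Unset Strict Implicit.
Unset Printing Implicit Defensive.

Import Order.TTheory GRing.Theory Num.Theory.
Import numFieldNormedType.Exports.
Local Open Scope classical_set_scope.
Local Open Scope ring_scope.

(** * Subadditivity and superadditivity of the counting measure *)

Section Counting.
Context {R : realType} {T : choiceType}.
Implicit Types A B : set T.
Local Notation counting := (@counting T R).

Lemma counting_fin A : finite_set A -> counting A = (#|` fset_set A|%:R)%:E.
Proof. by move=> finA; rewrite /counting asboolT. Qed.

Lemma counting_pinfty A : infinite_set A -> counting A = +oo%E.
Proof. by move=> infA; rewrite /counting asboolF. Qed.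

Lemma counting_ge0 A : (0 <= counting A)%E.
Proof. by rewrite /counting; case: ifP => _; rewrite ?lee_fin ?leey. Qed.

Lemma le_counting A B : A `<=` B -> (counting A <= counting B)%E.
Proof.
move=> AB; have [finB|infB] := pselect (finite_set B); last first.
  by rewrite (counting_pinfty infB) leey.
have finA := sub_finite_set AB finB.
rewrite !counting_fin// lee_fin ler_nat.
by apply: fsubset_leq_card; rewrite -fset_set_sub.
Qed.

Lemma counting_setU_le A B :
  (counting (A `|` B) <= counting A + counting B)%E.
Proof.
have notNy C : counting C != -oo%E by rewrite gt_eqF// (lt_le_trans (ltNyr 0))// counting_ge0.
have [finA|infA] := pselect (finite_set A); last first.
  by rewrite (counting_pinfty infA) addye ?leey.
have [finB|infB] := pselect (finite_set B); last first.
  by rewrite (counting_pinfty infB) addey ?leey.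
rewrite !counting_fin ?finite_setU// -EFinD lee_fin -natrD ler_nat.
by rewrite fset_setU// cardfsU leq_subr.
Qed.

Lemma counting_disjointU_ge A B : A `&` B = set0 ->
  (counting A + counting B <= counting (A `|` B))%E.
Proof.
move=> AB0; have [finU|infU] := pselect (finite_set (A `|` B)); last first.
  by rewrite (counting_pinfty infU) leey.
have [finA finB] : finite_set A /\ finite_set B by move: finU; rewrite finite_setU.
rewrite !counting_fin// -EFinD lee_fin -natrD ler_nat.
rewrite fset_setU// cardfsU -fset_setI// AB0 fset_set0.
by rewrite cardfs0 subn0.
Qed.

Lemma counting_subset1 A : is_subset1 A -> (counting A <= 1)%E.
Proof.
move=> A1; have [->|/set0P[x Ax]] := eqVneq A set0.
  by rewrite counting_fin// fset_set0 cardfs0 lee_fin.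
have -> : A = [set x] by apply/seteqP; split => [y Ay|_ ->//]; exact: A1.
by rewrite counting_fin// fset_set1 cardfs1.
Qed.

Lemma counting_cover_le (I : eqType) (s : seq I) (F : I -> set T) A (c : R) :
  (forall i, i \in s -> (counting (F i) <= c%:E)%E) ->
  (forall x, A x -> exists2 i, i \in s & F i x) ->
  (counting A <= ((size s)%:R * c)%:E)%E.
Proof.
elim: s A => [|i s IH] A Fc AF /=.
  have -> : A = set0 by rewrite -subset0 => x /AF[].
  by rewrite counting_fin// fset_set0 cardfs0 mul0r.
have sub : A `<=` F i `|` (A `\` F i).
  by move=> x Ax; have [Fx|Fx] := pselect (F i x); [left|right].
apply: (le_trans (le_counting sub)); apply: (le_trans (counting_setU_le _ _)).
rewrite -nat1r mulrDl mul1r EFinD leeD//.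
  by apply: Fc; rewrite mem_head.
apply: IH => [j js|x [/AF[j]]]; first by apply: Fc; rewrite in_cons js orbT.
by rewrite in_cons => /predU1P[->//|js Fx _]; exists j.
Qed.

Lemma counting_disjoint_ge (I : eqType) (s : seq I) (F : I -> set T) A (c : R) :
  uniq s ->
  (forall i, i \in s -> (c%:E <= counting (F i))%E) ->
  (forall i, i \in s -> F i `<=` A) ->
  (forall i j, i \in s -> j \in s -> i != j -> F i `&` F j = set0) ->
  (((size s)%:R * c)%:E <= counting A)%E.
Proof.
elim: s A => [|i s IH] A /=; first by rewrite mul0r counting_ge0.
move=> /andP[is_ us] cF FA Fdis.
have Asplit : F i `|` (A `\` F i) = A.
  by apply/setDUK/FA; rewrite mem_head.
rewrite -Asplit; apply: le_trans; last first.
  exact/counting_disjointU_ge/setDIK.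
rewrite -nat1r mulrDl mul1r EFinD leeD//.
  by apply: cF; rewrite mem_head.
have tl j : j \in s -> j \in i :: s by rewrite in_cons => ->; rewrite orbT.
apply: IH => // [j /tl|j js x Fjx|j k /tl js /tl]; [exact: cF| |exact: Fdis].
split; first exact: (FA j (tl _ js)).
move=> Fix; suff : set0 x by [].
rewrite -(Fdis i j (mem_head _ _) (tl _ js)); first by split.
by apply: contraNneq is_ => ->.
Qed.

End Counting.

Lemma counting_image_le {R : realType} {T U : choiceType} (f : T -> U) (A : set T) :
  (@counting U R (f @` A) <= @counting T R A)%E.
Proof.
have [finA|infA] := pselect (finite_set A); last first.
  by rewrite (counting_pinfty infA) leey.
rewrite !counting_fin//; last exact: finite_image.
by rewrite lee_fin ler_nat fset_set_image// leq_imfset_card.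
Qed.

(** * Sup-norm balls, upper density, and covering and packing estimates *)

Section Density.
Context {R : realType} {n : nat}.
Implicit Types (E F : set 'rV[R]_n) (x y v : 'rV[R]_n) (r s e : R).

Lemma mx_ballP x y r : 0 < r ->
  (forall j, `|x 0 j - y 0 j| < r) -> ball x r y.
Proof. by move=> r0 xy; split=> // i j; rewrite ord1 /= /ball /=; exact: xy. Qed.

Lemma mx_ball_coord x y r j : ball x r y -> `|x 0 j - y 0 j| < r.
Proof. by case=> _ /(_ 0 j). Qed.

Lemma mx_ball_translate x y v r : ball (x + v) r (y + v) <-> ball x r y.
Proof.
have E i j : (x + v) i j - (y + v) i j = x i j - y i j.
  by rewrite !mxE opprD addrACA subrr addr0.
by split=> -[r0 xy]; split=> // i j; move: (xy i j); rewrite /ball /= E.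
Qed.

Lemma vol_ballE r : 0 <= r -> vol_ball n r = (r *+ 2) ^+ n.
Proof.
move=> r0; rewrite /vol_ball lebesgue_measure_ball//= prodr_const.
by rewrite cardT size_enum_ord.
Qed.

Lemma vol_ball_gt0 r : 0 < r -> 0 < vol_ball n r.
Proof. by move=> r0; rewrite vol_ballE ?ltW// exprn_gt0// pmulrn_lgt0. Qed.

Lemma upper_density_leP r e E : 0 < r ->
  (upper_density r E <= e%:E)%E <->
  forall x, (counting (E `&` ball x r) <= (e * (r *+ 2) ^+ n)%:E)%E.
Proof.
move=> r0; rewrite -vol_ballE ?(ltW r0)//; have v0 := vol_ball_gt0 r0.
split=> [De x|Ee].
  rewrite EFinM -lee_pdivrMr//; apply: le_trans De.
  by apply: ereal_sup_ubound; exists x.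
by apply: ge_ereal_sup => _ [x _ <-]; rewrite lee_pdivrMr// -EFinM.
Qed.

Lemma le_upper_density r E F : 0 < r -> E `<=` F ->
  (upper_density r E <= upper_density r F)%E.
Proof.
move=> r0 EF; apply: ge_ereal_sup => _ [x _ <-].
apply: (@le_trans _ _ (counting (F `&` ball x r) * ((vol_ball n r)^-1)%:E)%E);
  last by apply: ereal_sup_ubound; exists x.
rewrite lee_wpmul2r ?lee_fin ?invr_ge0 ?(ltW (vol_ball_gt0 r0))//.
exact: (le_counting (setSI EF)).
Qed.

Lemma upper_densityU_le r E F : 0 < r ->
  (upper_density r (E `|` F) <= upper_density r E + upper_density r F)%E.
Proof.
move=> r0; apply: ge_ereal_sup => _ [x _ <-].
have v0 : (0 <= ((vol_ball n r)^-1)%:E)%E.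
  by rewrite lee_fin invr_ge0 (ltW (vol_ball_gt0 r0)).
rewrite setIUl; apply: (@le_trans _ _ ((counting (E `&` ball x r) +
    counting (F `&` ball x r)) * ((vol_ball n r)^-1)%:E)%E).
  by rewrite lee_wpmul2r// counting_setU_le.
rewrite ge0_muleDl ?counting_ge0//.
by apply: leeD; apply: ereal_sup_ubound; exists x.
Qed.

Lemma counting_translate_le E v x r :
  (counting (translate E v `&` ball (x + v)%R r) <=
   counting (E `&` ball x r) :> \bar R)%E.
Proof.
apply: le_trans (counting_image_le (fun y => y + v) _); apply: le_counting.
by move=> _ [[y Ey <-] /mx_ball_translate xy]; exists y.
Qed.

Lemma upper_density_translate_le r E v :
  (upper_density r (translate E v) <= upper_density r E)%E.
Proof.
have [r0|r0] := ltP 0 r; last first.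
  (* For [r <= 0] all balls are empty, so both suprema are over the same values. *)
  have b0 (x : 'rV[R]_n) A : A `&` ball x r = set0.
    by rewrite -subset0 => y [_ [/lt_le_trans/(_ r0)]]; rewrite ltxx.
  by rewrite /upper_density; under eq_imagel do rewrite b0;
     under [X in (_ <= ereal_sup X)%E]eq_imagel do rewrite b0.
apply: ge_ereal_sup => _ [x _ <-].
apply: (@le_trans _ _ (counting (E `&` ball (x - v)%R r) * ((vol_ball n r)^-1)%:E)%E);
  last by apply: ereal_sup_ubound; exists (x - v).
rewrite lee_wpmul2r ?lee_fin ?invr_ge0 ?(ltW (vol_ball_gt0 r0))//.
by rewrite -{1}(subrK v x) counting_translate_le.
Qed.

(** Balls of radius [r] centred on a grid of step [r] cover the ball of radius [s]. Each axis needs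
    [m <= 2 * s / r + 1] centres, which is at most [3 * s / r] because [r <= s]. *)
Lemma counting_ball_scale_le E (c r s : R) : 0 < r -> r <= s -> 0 <= c ->
  (forall x, (counting (E `&` ball x r) <= c%:E)%E) ->
  forall x, (counting (E `&` ball x s) <= ((3 * s / r) ^+ n * c)%:E)%E.
Proof.
move=> r0 rs c0 Ec x; have s0 := lt_le_trans r0 rs.
have sr0 : 0 <= s *+ 2 / r by rewrite divr_ge0// ?mulrn_wge0// ltW.
pose m := (Num.truncn (s *+ 2 / r)).+1.
pose ctr (i : {ffun 'I_n -> 'I_m}) := x + \row_j ((i j)%:R * r - s).
apply: (@le_trans _ _ ((size (enum {ffun 'I_n -> 'I_m}))%:R * c)%:E).
  apply: (@counting_cover_le _ _ _ _ (fun i => E `&` ball (ctr i) r)) => // y [Ey xy].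
  have ty j : 0 <= (y 0 j - x 0 j + s) / r < s *+ 2 / r.
    have := mx_ball_coord j xy; rewrite ltr_norml => /andP[h1 h2].
    rewrite divr_ge0 ?(ltW r0)//=; last lra.
    by rewrite ltr_pM2r ?invr_gt0// mulr2n; lra.
  (* Rounding each coordinate down to the grid moves it by less than [r]. *)
  exists [ffun j => inord (Num.truncn ((y 0 j - x 0 j + s) / r))].
    by rewrite mem_enum.
  split=> //; apply: mx_ballP => // j; have /andP[t0 t1] := ty j.
  rewrite !mxE ffunE inordK; last by rewrite ltnS le_truncn ?(ltW t1).
  have /andP[] := truncn_itv t0; set k := Num.truncn _ => k0 k1.
  move: k0 k1; rewrite ler_pdivlMr// ltr_pdivrMr// -natr1 mulrDl mul1r => k0 k1.
  by rewrite ltr_norml; apply/andP; split; lra.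
rewrite -cardE card_ffun !card_ord lee_fin ler_wpM2r// natrX lerXn2r ?nnegrE//.
  by rewrite mulr_ge0 ?invr_ge0 ?mulr_ge0// ltW.
have := rs; rewrite -{1}[r]mul1r -ler_pdivlMr// => sr1.
have := truncn_le (s *+ 2 / r); rewrite sr0 => tm.
rewrite -mulrA -[m%:R]natr1; move: tm; rewrite mulr2n (mulrDl s); lra.
Qed.

(** The ball of radius [k * r] is packed with [k ^ n] disjoint balls of radius [r], each containing
    a point of [E]. *)
Lemma counting_ball_ge E (r : R) (k : nat) : 0 < r -> (0 < k)%N ->
  (forall x, E `&` ball x r !=set0) ->
  (((k ^ n)%:R)%:E <= counting (E `&` ball (0 : 'rV[R]_n)%R (k%:R * r)%R) :> \bar R)%E.
Proof.
move=> r0 k0 Er.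
pose ctr (i : {ffun 'I_n -> 'I_k}) : 'rV[R]_n :=
  \row_j ((2 * (i j)%:R + 1 - k%:R) * r).
have -> : (k ^ n)%:R = (size (enum {ffun 'I_n -> 'I_k}))%:R * 1 :> R.
  by rewrite -cardE card_ffun !card_ord mulr1.
apply: (@counting_disjoint_ge _ _ _ _ (fun i => E `&` ball (ctr i) r)).
- exact: enum_uniq.
- move=> i _; have [y Ey] := Er (ctr i).
  apply: (@le_trans _ _ (counting [set y])); last by apply: le_counting => _ ->.
  by rewrite counting_fin// fset_set1 cardfs1.
- move=> i _ y [Ey iy]; split => //; apply: mx_ballP => [|j].
    by rewrite mulr_gt0// ltr0n.
  have := mx_ball_coord j iy; rewrite !mxE !ltr_norml => /andP[h1 h2].
  have ik : (i j)%:R + 1 <= k%:R :> R by rewrite natr1 ler_nat ltn_ord.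
  have := ler_wpM2r (ltW r0) ik; rewrite mulrDl mul1r => ikr.
  have : 0 <= (i j)%:R * r by rewrite mulr_ge0// ltW.
  move: h1 h2; rewrite mulrBl mulrDl mul1r -mulrA => h1 h2 h3.
  by apply/andP; split; lra.
move=> i i' _ _ /eqP ii'; rewrite -subset0 => y [[_ iy] [_ i'y]]; apply: ii'.
apply/ffunP => j; apply/val_inj/eqP.
have := mx_ball_coord j iy; have := mx_ball_coord j i'y.
rewrite !mxE !ltr_norml !mulrBl !mulrDl mul1r -!mulrA.
move=> /andP[h1 h2] /andP[h3 h4].
have lt_nat (a b : nat) : a%:R * r < b%:R * r + r -> (a <= b)%N.
  by rewrite -{3}[r]mul1r -mulrDl ltr_pM2r// natr1 ltr_nat ltnS.
by rewrite /= eqn_leq; apply/andP; split; apply: lt_nat; lra.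
Qed.

End Density.

(** * Almost-periods as sublevel sets of a pseudo-norm *)

Section AlmostPeriods.
Context {R : realType} {n : nat}.
Implicit Types (G : set 'rV[R]_n) (v w x y : 'rV[R]_n) (a b r s : R).

Lemma translateP G v x : translate G v x <-> G (x - v).
Proof.
split=> [[g Gg <-]|Gx]; first by rewrite addrK.
by exists (x - v) => //; rewrite subrK.
Qed.

Lemma relatively_denseS G G' :
  G `<=` G' -> relatively_dense G -> relatively_dense G'.
Proof.
move=> GG' [r r0 Gr]; exists r => // x s rs.
by have [y [/GG' ? ?]] := Gr x s rs; exists y.
Qed.

Lemma uniformly_discreteS G G' :
  G `<=` G' -> uniformly_discrete G' -> uniformly_discrete G.
Proof.
move=> GG' [r r0 Gr]; exists r => // x s rs y z [/GG' ? ?] [/GG' ? ?].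
exact: (Gr x s rs).
Qed.

Lemma almost_periods_le G a b : a <= b ->
  almost_periods G a `<=` almost_periods G b.
Proof.
move=> ab v [s s0 vs]; exists s => // r sr.
by apply: (lt_le_trans (vs r sr)); rewrite lee_fin.
Qed.

(** Triangle inequality for symmetric differences: [G + v + w] differs from [G] only where
    [G + v + w] differs from [G + w] or [G + w] from [G]; the first set is a translate of the
    symmetric difference of [G + v] and [G]. *)
Lemma almost_periodsD G a b v w :
  almost_periods G a v -> almost_periods G b w ->
  almost_periods G (a + b) (v + w).
Proof.
move=> [s /= s0 vs] [s' /= s'0 ws]; exists (Num.max s s').
  by rewrite /= lt_max s0.
move=> r; rewrite ge_max => /andP[sr s'r]; have r0 := lt_le_trans s0 sr.
rewrite EFinD; apply: le_lt_trans (lteD (vs r sr) (ws r s'r)).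
apply: (@le_trans _ _ (upper_density r
    (translate (translate G v `+` G) w `|` (translate G w `+` G)))).
  apply: le_upper_density => // x.
  rewrite /setY /= !translateP /setU /setD /= !translateP opprD addrA addrAC.
  by have [] := pselect (G (x - w)); tauto.
apply: le_trans (upper_densityU_le _ _ r0) _.
by rewrite leeD2r// upper_density_translate_le.
Qed.

Lemma almost_periodsN G a v :
  almost_periods G a v -> almost_periods G a (- v).
Proof.
move=> [s /= s0 vs]; exists s => // r sr; have r0 := lt_le_trans s0 sr.
apply: le_lt_trans (vs r sr).
apply: le_trans (upper_density_translate_le _ _ (- v)).
apply: le_upper_density => // x.
by rewrite /setY /= !translateP /setU /setD /= !translateP opprK addrK; tauto.
Qed.

Lemma almost_periodsB G a b v w :
  almost_periods G a v -> almost_periods G b w ->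
  almost_periods G (a + b) (v - w).
Proof. by move=> av /almost_periodsN; exact: almost_periodsD. Qed.

Lemma almost_periods_translate_diff G t d w : 0 <= d -> almost_periods G d w ->
  translate (almost_periods G t) w `+` almost_periods G t `<=`
  almost_periods G (t + d) `\` almost_periods G (t - d).
Proof.
move=> d0 dw x [[/translateP tx ntx]|[tx ntx]]; split.
- by rewrite -(subrK w x); exact: almost_periodsD.
- by apply: contra_not ntx; apply: almost_periods_le; rewrite gerBl.
- by apply: almost_periods_le tx; rewrite lerDl.
- apply: contra_not ntx => xt; apply/translateP.
  by rewrite -(subrK d t); exact: almost_periodsB.
Qed.

Lemma almost_periods_uniformly_discrete G : delone G ->
  exists2 e : R, 0 < e & uniformly_discrete (almost_periods G e).
Proof.
move=> [[rG rG0 Gd] [r r0 Gu]].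
have vol0 : 0 < (rG *+ 2) ^+ n by rewrite exprn_gt0// pmulrn_lgt0.
(* Packing gives [G] density at least [((rG *+ 2) ^+ n)^-1] at multiples of [rG]. A difference of
   two elements of [N e] is a [2 * e]-almost-period, and [2 * e] is below that density. *)
pose e := ((rG *+ 2) ^+ n)^-1 / 3.
have e0 : 0 < e by rewrite divr_gt0// invr_gt0.
exists e => //; exists (r / 2) => [|x s sr v w [ev xv] [ew xw]].
  by rewrite divr_gt0.
have [//|vw] := eqVneq v w; exfalso.
have [s' /= s'0 /(_ ((Num.truncn (s' / rG)).+1%:R * rG))] := almost_periodsB ev ew.
set k := (Num.truncn _).+1 => /(_ _)/ltW.
have k0 : 0 < k%:R * rG by rewrite mulr_gt0// ltr0n.
have s'k : s' <= k%:R * rG by rewrite -ler_pdivrMr// ltW// truncnS_gt.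
move=> /(_ s'k) /(upper_density_leP _ _ k0)/(_ 0).
(* Since [v - w] is shorter than [r], a point [g - (v - w)] of [G] would have to equal [g]; so the
   translate misses [G] entirely. *)
have Gsub : G `<=` translate G (v - w) `+` G.
  move=> g Gg; right; split => // /translateP Gg'.
  have : g = g - (v - w).
    apply: (Gu g r) => //; split => //; first exact: ballxx.
    have : ball v r w.
      by have := ball_triangle (ball_sym xv) xw; apply: le_ball; lra.
    move=> /(proj2 (mx_ball_translate v w (g - v) r)); rewrite addrCA subrr addr0.
    by rewrite opprB (addrCA g).
  move=> /eqP; rewrite eq_sym -subr_eq0 addrAC subrr add0r oppr_eq0 subr_eq0.
  by rewrite (negbTE vw).
apply/negP; rewrite -ltNge.
apply: lt_le_trans (le_counting (setSI Gsub)).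
apply: lt_le_trans (counting_ball_ge rG0 (ltn0Sn _) _); last first.
  by move=> y; exact: Gd.
rewrite lte_fin -mulrnAr exprMn natrX.
have -> : (e + e) * (k%:R ^+ n * (rG *+ 2) ^+ n) = 2 / 3 * k%:R ^+ n.
  by rewrite /e; field; rewrite lt0r_neq0.
by rewrite gtr_pMl ?exprn_gt0 ?ltr0n//; lra.
Qed.
End AlmostPeriods.

Lemma seq_pos_lower_bound {R : realType} (s : seq R) :
  (forall x, x \in s -> 0 < x) -> exists2 d, 0 < d & forall x, x \in s -> d <= x.
Proof.
elim: s => [_|y s IH ys]; first by exists 1.
have [x xs|d d0 ds] := IH; first by apply: ys; rewrite in_cons xs orbT.
exists (Num.min d y); first by rewrite lt_min d0 ys ?mem_head.
move=> x; rewrite in_cons => /predU1P[->|/ds dx]; first by rewrite ge_min lexx orbT.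
by rewrite ge_min dx.
Qed.

Lemma itv_not_countable {R : realType} (a b : R) : a < b -> ~ countable `]a, b[.
Proof.
move=> ab /countable_lebesgue_measure0/eqP.
by rewrite lebesgue_measure_itv/= lte_fin ab -EFinB eqe subr_eq0 gt_eqF.
Qed.

(** * Choice of a level whose thin shells have small density *)

Section Level.
Context {R : realType} {n : nat}.
Variables (N : R -> set 'rV[R]_n) (e : R) (L : R -> R).
Hypothesis N_le : forall a b, a <= b -> N a `<=` N b.
Hypothesis N_discrete : uniformly_discrete (N e).

(* [L d] is meant as a radius from which on every ball meets [N d]. *)
Let heavy (eta : R) : set R := [set t | 0 < t < e /\ forall d r : R,
  0 < d -> 0 < r -> L d <= r ->
  ((eta * (r *+ 2) ^+ n)%:E <
    counting ((N (t + d *+ 2) `\` N (t - d *+ 2)) `&` ball (0 : 'rV[R]_n)%R (r *+ 2)%R))%E].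

(** Disjoint shells of heavy levels all lie in [N e], whose count in a ball of radius [r *+ 2] is at
    most a constant times [(r *+ 2) ^+ n]. This factor cancels, which bounds the number of levels
    independently of [r]. *)
Let finite_heavy eta : 0 < eta -> finite_set (heavy eta).
Proof.
move=> eta0; apply: contrapT => infH.
have [rN rN0 Nd] := N_discrete.
have [B BH Bsize] := infinite_set_fset (Num.truncn ((3 / rN) ^+ n / eta)).+1 infH.
pose s := enum_fset B.
have sH t : t \in s -> heavy eta t by move=> ts; apply: BH.
have [d1 d10 d1s] : exists2 d, 0 < d & forall x, x \in
    [seq `|p.1 - p.2| | p <- [seq (x, y) | x <- s, y <- s] & p.1 != p.2] -> d <= x.
  apply: seq_pos_lower_bound => x /mapP[p]; rewrite mem_filter => /andP[p12 _] ->.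
  by rewrite normr_gt0 subr_eq0.
have [d2 d20 d2s] : exists2 d, 0 < d & forall x, x \in [seq e - t | t <- s] -> d <= x.
  apply: seq_pos_lower_bound => x /mapP[t /sH[/andP[_ te] _] ->].
  by rewrite subr_gt0.
(* Shells reach [2 * d] on either side of their level: gaps of at least [4 * d] between levels make
   them disjoint, and a distance of at least [4 * d] to [e] keeps them in [N e]. *)
pose d := Num.min d1 d2 / 4.
have d0 : 0 < d by rewrite divr_gt0// lt_min d10.
have dd1 : d *+ 4 <= d1 by rewrite -mulr_natr divfK ?pnatr_eq0// ge_min lexx.
have dd2 : d *+ 4 <= d2 by rewrite -mulr_natr divfK ?pnatr_eq0// ge_min lexx orbT.
pose r := Num.max rN (L d).
have rNr : rN <= r by rewrite le_max lexx.
have r0 : 0 < r by exact: lt_le_trans rNr.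
have Lr : L d <= r by rewrite le_max lexx orbT.
have vol0 : 0 < (r *+ 2) ^+ n by rewrite exprn_gt0// pmulrn_lgt0.
have lo : (((size s)%:R * (eta * (r *+ 2) ^+ n))%:E <=
    counting (N e `&` ball (0 : 'rV[R]_n)%R (r *+ 2)%R))%E.
  apply: (@counting_disjoint_ge _ _ _ _
    (fun t => (N (t + d *+ 2) `\` N (t - d *+ 2)) `&` ball (0 : 'rV[R]_n)%R (r *+ 2)%R)).
  - exact: fset_uniq.
  - by move=> t /sH[_ /(_ d r d0 r0 Lr)/ltW].
  - move=> t ts x [[xN _] x0]; split => //; apply: N_le xN.
    have := d2s _ (map_f _ ts); move: dd2 d0; rewrite !mulr2n -[d *+ 4]mulr_natr; lra.
  have dis t t' : t \in s -> t' \in s -> t < t' ->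
      N (t + d *+ 2) `<=` N (t' - d *+ 2).
    move=> ts t's tt'; apply: N_le.
    have : d1 <= `|t - t'|.
      apply: d1s; apply/mapP; exists (t, t') => //.
      by rewrite mem_filter /= lt_eqF//=; apply/allpairsP; exists (t, t').
    rewrite ltr0_norm ?subr_lt0//.
    move: dd1; rewrite !mulr2n -[d *+ 4]mulr_natr; lra.
  move=> t t' ts t's; rewrite neq_lt -subset0 => /orP[] tt' x [[[h1 h2] _] [[h3 h4] _]].
    exact/h4/(dis _ _ ts t's tt').
  exact/h2/(dis _ _ t's ts tt').
have hi : (counting (N e `&` ball (0 : 'rV[R]_n)%R (r *+ 2)%R) <=
    ((3 * (r *+ 2) / rN) ^+ n * 1)%:E)%E.
  apply: counting_ball_scale_le => // [|x].
    by apply: le_trans rNr _; rewrite mulr2n lerDl ltW.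
  exact/counting_subset1/Nd.
have := le_trans lo hi; rewrite lee_fin mulr1.
have -> : 3 * (r *+ 2) / rN = 3 / rN * (r *+ 2) by rewrite mulrAC.
rewrite exprMn mulrA ler_pM2r// -ler_pdivlMr// => sle.
have := le_lt_trans sle (truncnS_gt _).
by rewrite ltr_nat ltnNge Bsize.
Qed.

(** Levels heavy for some [k.+1%:R^-1] form a countable union of finite sets, which cannot exhaust
    []0, e[]. *)
Lemma exists_light_level : 0 < e -> exists2 t, 0 < t < e &
  forall eta, 0 < eta -> exists d r, [/\ 0 < d, 0 < r, L d <= r &
    (counting ((N (t + d *+ 2) `\` N (t - d *+ 2)) `&`
       ball (0 : 'rV[R]_n)%R (r *+ 2)%R) <= (eta * (r *+ 2) ^+ n)%:E)%E].
Proof.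
move=> e0; apply: contrapT => noT; apply: (itv_not_countable e0).
apply: (@sub_countable _ _ _ (\bigcup_k heavy k.+1%:R^-1)); last first.
  by apply: bigcup_countable => // k _; exact/finite_set_countable/finite_heavy.
apply: subset_card_le => t /=; rewrite in_itv /= => te.
apply: contrapT => light; apply: noT; exists t => // eta eta0.
apply: contrapT => heavyt; apply: light.
exists (Num.truncn eta^-1) => //; split=> // d r d0 r0 Lr.
rewrite ltNge; apply/negP => le; apply: heavyt; exists d, r; split=> //.
apply: le_trans le _; rewrite lee_fin ler_wpM2r ?exprn_ge0 ?mulrn_wge0 ?(ltW r0)//.
by rewrite invf_ple ?posrE// ltW// truncnS_gt.
Qed.

End Level.

(** * The pattern [N t] *)

Theorem proposition16 (R : realType) (n : nat) (hn : (1 <= n)%N)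
    (G : set 'rV[R]_n) (hG : almost_periodic_pattern G)
    (eps : R) (heps : 0 < eps) :
  exists L : set 'rV[R]_n,
    [/\ L `<=` almost_periods G eps,
        relatively_dense L &
        almost_periodic_pattern L].
Proof.
have [deloneG perG] := hG.
pose N := almost_periods G.
have Ndense d : 0 < d -> relatively_dense (N d).
  move=> /perG[r r0]; apply: relatively_denseS => v vr; by exists r.
have [e1 e10 Ne1] := almost_periods_uniformly_discrete deloneG.
pose e := Num.min e1 eps.
have e0 : 0 < e by rewrite lt_min e10.
have Ne : uniformly_discrete (N e).
  by apply: uniformly_discreteS Ne1; apply: almost_periods_le; rewrite ge_min lexx.
have /choice[L NL] : forall d, exists l, 0 < d ->
    forall (x : 'rV[R]_n) r, l <= r -> N d `&` ball x r !=set0.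
  move=> d; have [/Ndense[l _ dl]|d0] := ltP 0 d; first by exists l.
  by exists 0.
have Nle := @almost_periods_le R n G.
have [t /andP[t0 te] light] := exists_light_level L Nle Ne e0.
exists (N t); split.
- by apply: Nle; rewrite (le_trans (ltW te))// ge_min lexx orbT.
- exact: Ndense.
split; first by split; [exact: Ndense|apply: uniformly_discreteS Ne; exact/Nle/ltW].
move=> eta eta0.
(* The factor [3 ^+ n] pays for passing from radius [r] to any [s >= r]; halving makes the final
   inequality strict. *)
have [|d [r [d0 r0 Lr lightr]]] := light (eta / 2 / 3 ^+ n).
  by rewrite !divr_gt0// exprn_gt0.
exists r => //; apply: relatively_denseS (Ndense d d0) => w dw s rs.
have s0 := lt_le_trans r0 rs.
apply: (@le_lt_trans _ _ (eta / 2)%:E); last by rewrite lte_fin; lra.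
apply/upper_density_leP => // x.
have -> : eta / 2 * (s *+ 2) ^+ n =
    (3 * s / r) ^+ n * (eta / 2 / 3 ^+ n * (r *+ 2) ^+ n).
  rewrite -[s *+ 2]mulr_natr -[r *+ 2]mulr_natr !exprMn exprVn.
  by field; rewrite !expf_neq0 ?pnatr_eq0 ?lt0r_neq0.
apply: counting_ball_scale_le x => // [|x].
  by rewrite mulr_ge0 ?exprn_ge0 ?mulrn_wge0 ?(ltW r0)// !divr_ge0 ?exprn_ge0 ?(ltW eta0).
apply: le_trans lightr.
(* Translation by [w'] brings the centre [x] to within [r] of 0, so the moved ball lies in the ball
   of radius [r *+ 2] about 0. *)
have [w' [dw' xw']] := NL d d0 (- x) r Lr.
set F := N _ `\` N _.
have xw'r : ball 0 r (x + w').
  by rewrite (addrC x) -(addNr x); apply/mx_ball_translate.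
apply: (@le_trans _ _ (counting (translate F (- w') `&` ball (x + w' - w') r))).
  (* [w] puts [y] in the shell of half-width [d]; adding [w'] shifts levels by at most [d] more, so
     [y + w'] is in [F]. *)
  apply: le_counting; rewrite addrK => y [/almost_periods_translate_diff yN xy].
  split => //; apply/translateP; rewrite opprK.
  have [yu yl] := yN _ (ltW d0) dw; split.
    by rewrite mulr2n addrA; exact: almost_periodsD.
  apply: contra_not yl => yl; rewrite -(addrK w' y).
  by rewrite (_ : t - d = t - d *+ 2 + d); [exact: almost_periodsB|ring].
apply: le_trans (counting_translate_le _ _ _ _) _; apply: le_counting.
move=> y [Fy xwy]; split => //; rewrite mulr2n.
exact: ball_triangle xw'r xwy.
Qed.
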